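(* Let $V=V_1\ast\dots\ast V_r$ be a free product of finite sets, and let $h=\lim_{n\to\infty}\frac1n\mathbb{E}[-\log\pi_n(X_n)]$ be the asymptotic entropy of the random walk $(X_n)_{n\ge0}$ on $V$. Then $$h\le g_0\cdot\ell_0\qquad\text{and}\qquad h\le g_1\cdot\ell_1,$$ where $\ell_0,\ell_1$ are the rates of escape and $g_0,g_1$ the volume growth rates with respect to the block length and the natural graph metric, respectively.
   Context: Free product. Let $r\ge 2$, $\mathcal I=\{1,\dots,r\}$. For $i\in\mathcal I$ let $V_i$ be a finite set with distinguished root $o_i\in V_i$ (the $V_i$ pairwise disjoint) and let $P_i=(p_i(x,y))_{x,y\in V_i}$ be a stochastic transition matrix, with $n$-step probabilities $p_i^{(n)}(x,y)$. The case $r=2=|V_1|=|V_2|$ is excluded. Standing assumptions: for every $x\in V_i$ there is $n\in\mathbb N$ with $p_i^{(n)}(o_i,x)>0$; $p_i(x,x)=0$ for all $x\in V_i$. Put $V_i^\times=V_i\setminus\{o_i\}$, $V_\ast^\times=\bigcup_i V_i^\times$. The free product $V$ is the set of all finite words $x_1\dots x_n$ with letters in $V_\ast^\times$, no two consecutive letters from the same $V_i$, together with the empty word $o$. Each $o_i$ is identified with $o$, so $V_i\subseteq V$, and $xo_i:=x$. For $u=u_1\dots u_m\in V$: block length $\|u\|=m$ ($\|o\|=0$), type $\tau(u)=i$ if $u_m\in V_i^\times$ ($\tau(o)=0$). Random walk. For $x\in V$ with $\tau(x)\ne i$ and $v,w\in V_i$ put $\bar p_i(xv,xw)=p_i(v,w)$,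 and $\bar p_i=0$ otherwise. Fix $\alpha_1,\dots,\alpha_r>0$ with $\sum_i\alpha_i=1$ and let $P=\sum_i\alpha_i\bar P_i$, with $n$-step probabilities $p^{(n)}(x,y)$. $(X_n)_{n\ge0}$ is the Markov chain on $V$ with $X_0=o$ and transition matrix $P$; $\pi_n$ is the distribution of $X_n$. Standing assumption: the radius of convergence $R$ of the Green functions $G(x,y|z)=\sum_{n\ge0}p^{(n)}(x,y)z^n$ (the infimum over $x,y\in V$ of the radii of convergence) satisfies $R>1$. Then the limit $h$ exists. Lengths and growth. $l_0(x)=\|x\|$ and $l_1(x)=\inf\{m\ge0: p^{(m)}(o,x)>0\}$ for $x\in V$. For $i\in\{0,1\}$: $\ell_i=\lim_{n\to\infty}l_i(X_n)/n$ (these almost sure constant limits exist), $B_i(n)=\{x\in V: l_i(x)\le n\}$, and $g_i=\lim_{n\to\infty}\frac1n\log|B_i(n)|$ (these limits exist). *)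

(* Defs.v *)
From HB Require Import structures.
From mathcomp Require Export all_boot all_order all_algebra.
From mathcomp Require Export finmap.
From mathcomp Require Export all_classical all_reals all_analysis.

Set Implicit Arguments.
Unset Strict Implicit.
Unset Printing Implicit Defensive.

Import Order.TTheory GRing.Theory Num.Theory.
Import numFieldNormedType.Exports.
Local Open Scope classical_set_scope.
Local Open Scope ring_scope.

(* The finitely supported sum is the usual matrix product whenever the rows of
   q have finite support, as is the case for each P_i and for P below. *)
Fixpoint nstep (R : realType) (T : choiceType) (q : T -> T -> R) (n : nat)
    (x y : T) : R :=
  if n is m.+1 then \sum_(z \in [set: T]) q x z * nstep q m z y
  else (x == y)%:R.

Definition stochastic (R : realType) (T : finType) (q : T -> T -> R) : Prop :=
  (forall x y, 0 <= q x y) /\ (forall x, \sum_(y : T) q x y = 1).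

Section FreeProduct.
Context {r : nat} {V : 'I_r -> finType} (o : forall i, V i).

(* The tag makes the V_i disjoint. *)
Definition letter : Type := {i : 'I_r & V i}.

Definition reduced (s : seq letter) : bool :=
  all (fun a : letter => tagged a != o (tag a)) s &&
  sorted (fun a b : letter => tag a != tag b) s.

Record freeProduct := FreeProduct {
  word :> seq letter;
  word_reduced : reduced word }.

HB.instance Definition _ := [isSub for word].
HB.instance Definition _ := [Countable of freeProduct by <:].

Definition emptyWord : freeProduct := @FreeProduct [::] isT.

Definition blockLength (x : freeProduct) : nat := size x.

(* None plays the role of the type 0 of the empty word. *)
Definition wtype (x : freeProduct) : option 'I_r :=
  if word x is a :: s then Some (tag (last a s)) else None.

(* The word x v for v in V_i, with the convention x o_i = x. *)
Definition appendLetter (x : freeProduct) (i : 'I_r) (v : V i) : seq letter :=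
  if v == o i then word x else rcons x (Tagged V v).

End FreeProduct.

Section Walk.
Context {R : realType} {r : nat} {V : 'I_r -> finType}.
Variables (o : forall i, V i) (p : forall i, V i -> V i -> R) (alpha : 'I_r -> R).

(* The set below has at most one element, because x, v and w are determined by
   a, b and i; see liftKernelE. *)
Definition liftKernel (i : 'I_r) (a b : freeProduct o) : R :=
  xget 0 [set q | exists (x : freeProduct o) (v w : V i),
    [/\ wtype x <> Some i, word a = appendLetter x v,
        word b = appendLetter x w & q = p v w]].

Definition walkKernel (a b : freeProduct o) : R :=
  \sum_(i < r) alpha i * liftKernel i a b.

(* The set is never empty: every word is reachable from the empty one under the
   reachability assumption on the V_i. *)
Definition graphLength (x : freeProduct o) : R :=
  inf [set m%:R | m in [set m : nat | 0 < nstep walkKernel m (emptyWord o) x]].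

Definition greenRadius : \bar R :=
  ereal_inf [set ereal_sup
    [set z%:E | z in [set z : R | 0 <= z /\
       cvgn (pseries (fun n => nstep walkKernel n xy.1 xy.2) z)]]
    | xy in [set: freeProduct o * freeProduct o]].

End Walk.

Lemma appendLetter_inj (r : nat) (V : 'I_r -> finType) (o : forall i, V i)
    (i : 'I_r) (x y : freeProduct o) (v w : V i) :
  wtype x <> Some i -> wtype y <> Some i ->
  appendLetter x v = appendLetter y w -> x = y /\ v = w.
Proof.
have wtype_rcons (z : freeProduct o) s (u : V i) :
    word z = rcons s (Tagged V u) -> wtype z = Some i.
  rewrite /wtype; case: s => [|a s] -> //=.
  by rewrite last_rcons.
rewrite /appendLetter => tx ty.
case: eqP => [->|nv]; case: eqP => [->|nw] e.
- by split=> //; apply: val_inj.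
- by case: tx; apply: wtype_rcons e.
- by case: ty; apply: wtype_rcons (esym e).
- have [exy /eqP evw] := rcons_inj e.
  by split; [apply: val_inj | move: evw; rewrite eq_Tagged => /eqP].
Qed.

Lemma liftKernelE (R : realType) (r : nat) (V : 'I_r -> finType)
    (o : forall i, V i) (p : forall i, V i -> V i -> R) (i : 'I_r)
    (x a b : freeProduct o) (v w : V i) :
  wtype x <> Some i -> word a = appendLetter x v ->
  word b = appendLetter x w -> liftKernel p i a b = p i v w.
Proof.
move=> tx ea eb; rewrite /liftKernel; case: xgetP => [q _|]; last first.
  by move=> /(_ (p i v w)) []; exists x, v, w.
move=> [y [v' [w' [ty ea' eb' ->]]]].
have [_ ->] := appendLetter_inj tx ty (etrans (esym ea) ea').
by have [_ ->] := appendLetter_inj tx ty (etrans (esym eb) eb').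
Qed.

(* T is countable, so measurability of the fibres is measurability of X n. *)
Definition markovChain (R : realType) (T : countType) (q : T -> T -> R) (x0 : T)
    (d : measure_display) (Omega : measurableType d)
    (Pr : probability Omega R) (X : nat -> Omega -> T) : Prop :=
  [/\ forall n x, measurable (X n @^-1` [set x]),
      Pr (X 0%N @^-1` [set x0]) = 1%E &
      forall (n : nat) (x : nat -> T),
        Pr [set w | forall k, (k <= n.+1)%N -> X k w = x k] =
        (Pr [set w | forall k, (k <= n)%N -> X k w = x k] *
           (q (x n) (x n.+1))%:E)%E].

Definition law (R : realType) (T : countType) (d : measure_display)
    (Omega : measurableType d) (Pr : probability Omega R) (Y : Omega -> T)
    (x : T) : R := fine (Pr (Y @^-1` [set x])).

Definition isAsymptoticEntropy (R : realType) (T : countType)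
    (d : measure_display) (Omega : measurableType d) (Pr : probability Omega R)
    (X : nat -> Omega -> T) (h : R) : Prop :=
  ((n%:R^-1)%:E * 'E_Pr[fun w => (- ln (law Pr (X n) (X n w)))%R])%E
    @[n --> \oo] --> h%:E.

Definition isRateOfEscape (R : realType) (T : countType) (len : T -> R)
    (d : measure_display) (Omega : measurableType d) (Pr : probability Omega R)
    (X : nat -> Omega -> T) (ell : R) : Prop :=
  {ae Pr, forall w, len (X n w) / n%:R @[n --> \oo] --> ell}.

(* For both lengths of interest the balls are finite, so fset_set keeps all of
   their elements (it sends infinite sets to the empty one). *)
Definition isGrowthRate (R : realType) (T : countType) (len : T -> R) (g : R)
    : Prop :=
  ln (#|` fset_set [set x : T | len x <= n%:R]|)%:R / n%:R
    @[n --> \oo] --> g.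

(* Main.v *)
Require Import Defs.
From mathcomp Require Import measurable_realfun.

Import Order.TTheory GRing.Theory Num.Theory.
Import numFieldNormedType.Exports.
Local Open Scope classical_set_scope.
Local Open Scope ring_scope.

(** Both inequalities hold for any length with finite balls [B(n)] such that
    [X n] lies in [B(n)] almost surely. Fix [e > 0] and put [m ~ (l + e) n].
    Since a law on [N] points has entropy at most [ln N], splitting along the
    event [len (X n) > m], of probability [delta_n], gives
    [H(X n) <= ln |B(m)| + delta_n * ln |B(n)| + 2]. Almost sure convergence of
    [len (X n) / n] forces [delta_n -> 0], so after division by [n] the right-hand
    side tends to [g * (l + e)]. For the graph metric, finiteness of the balls
    uses that every word is reachable from the empty one. *)

(** * Positivity of [n]-step probabilities for kernels with finite rows *)

Section NstepPositivity.
Context {R : realType} {T : choiceType}.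
Context {q : T -> T -> R}.
Hypothesis q_ge0 : forall x y, 0 <= q x y.
Hypothesis q_fin : forall x, finite_set [set y | q x y != 0].

Lemma nstep_ge0 n x y : 0 <= nstep q n x y.
Proof.
elim: n x => [|n IH] x /=; first by rewrite ler0n.
by apply: fsumr_ge0 => z _; rewrite mulr_ge0.
Qed.

(** One positive term suffices, the others being nonnegative. Finite rows matter here: a finitely
    supported sum takes the default value 0 when its support is infinite. *)
Lemma nstep_gt0S {n x y z} : 0 < q x y -> 0 < nstep q n y z -> 0 < nstep q n.+1 x z.
Proof.
move=> qxy nyz /=; rewrite -(@fsbig_widen _ _ _ _ [set y | q x y != 0])//=; last first.
  by move=> w /= [_ /negP]; rewrite negbK => /eqP->; rewrite mul0r.
rewrite (fsbigD1 y) ?q_fin//=; last by rewrite gt_eqF.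
apply: ltr_pwDl; first exact: mulr_gt0.
by apply: fsumr_ge0 => w _; rewrite mulr_ge0 ?nstep_ge0.
Qed.

Lemma nstep_gt0_inv {n x z} : 0 < nstep q n.+1 x z ->
  exists2 y, 0 < q x y & 0 < nstep q n y z.
Proof.
move=> H; apply: contrapT => nex; move: H => /=; rewrite fsbig1 ?ltxx// => y _.
have [qxy|] := ltP 0 (q x y); last first.
  by move=> qle; have /eqP-> : q x y == 0; rewrite ?mul0r// eq_le qle q_ge0.
have [nyz|] := ltP 0 (nstep q n y z); first by case: nex; exists y.
by move=> nle; have /eqP-> : nstep q n y z == 0; rewrite ?mulr0// eq_le nle nstep_ge0.
Qed.

Lemma nstep_gt0_trans {m n x y z} :
  0 < nstep q m x y -> 0 < nstep q n y z -> 0 < nstep q (m + n) x z.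
Proof.
elim: m x => [|m IH] x; first by rewrite /= ltr0n lt0b => /eqP->.
by move=> /nstep_gt0_inv[w qxw nwy] nyz; rewrite addSn; apply: nstep_gt0S qxw (IH _ nwy nyz).
Qed.

End NstepPositivity.

(** * Words of the free product: finite balls, lifted paths and reachability *)

Lemma finite_seq_le (A : finType) n : finite_set [set s : seq A | (size s <= n)%N].
Proof.
elim: n => [|n IH].
  apply: sub_finite_set (finite_set1 [::]) => s /=; by rewrite leqn0 size_eq0 => /eqP.
have fA : finite_set [set: A] by exact: finite_finset.
have fU : finite_set ([set [::]] `|` [set x :: y | x in [set: A] & y in [set s | (size s <= n)%N]]).
  by rewrite finite_setU; split; [exact: finite_set1 | exact: finite_image2].
apply: sub_finite_set fU => -[|a s] /= ss; first by left.
by right; exists a => //; exists s.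
Qed.

Section Words.
Context {R : realType} {r : nat} {V : 'I_r -> finType}.
Variables (o : forall i, V i) (p : forall i, V i -> V i -> R) (alpha : 'I_r -> R).
Hypothesis p_ge0 : forall i (x y : V i), 0 <= p i x y.
Hypothesis alpha_gt0 : forall i, 0 < alpha i.

Implicit Types a b x y : freeProduct o.

Lemma finite_blockLength_le n : finite_set [set x : freeProduct o | (blockLength x <= n)%N].
Proof.
apply: (@finite_preimage _ _ [set s | (size s <= n)%N] (@word r V o)).
  by move=> a b _ _; apply: val_inj.
exact: (@finite_seq_le {i : 'I_r & V i} n).
Qed.

Lemma size_appendLetter x {i} (v : V i) :
  (size x <= size (appendLetter x v) <= (size x).+1)%N.
Proof. by rewrite /appendLetter; case: ifP; rewrite ?size_rcons leqnn leqnSn. Qed.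

Lemma liftKernel_ge0 i a b : 0 <= liftKernel p i a b.
Proof.
by rewrite /liftKernel; case: xgetP => // q _ [x [v [w [_ _ _ ->]]]].
Qed.

Lemma liftKernel_neq0_blockLength {i a b} :
  liftKernel p i a b != 0 -> (blockLength b <= (blockLength a).+1)%N.
Proof.
rewrite /liftKernel; case: xgetP => [q _ [x [v [w [_ ea eb _]]]] _|]; last by rewrite eqxx.
rewrite /blockLength ea eb.
have /andP[_ /leq_trans] := size_appendLetter x w; apply.
by rewrite ltnS; have /andP[] := size_appendLetter x v.
Qed.

Lemma walkKernel_ge0 a b : 0 <= walkKernel p alpha a b.
Proof. by apply: sumr_ge0 => i _; rewrite mulr_ge0 ?liftKernel_ge0// ltW. Qed.

Lemma walkKernel_gt0 {i a b} : 0 < liftKernel p i a b -> 0 < walkKernel p alpha a b.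
Proof.
move=> H; rewrite /walkKernel (bigD1 i)//=; apply: ltr_pwDl; first exact: mulr_gt0.
by apply: sumr_ge0 => j _; rewrite mulr_ge0 ?liftKernel_ge0// ltW.
Qed.

Lemma walkKernel_neq0_blockLength {a b} :
  walkKernel p alpha a b != 0 -> (blockLength b <= (blockLength a).+1)%N.
Proof.
apply: contraNT => nab; rewrite /walkKernel big1// => i _.
have [->|/liftKernel_neq0_blockLength] := eqVneq (liftKernel p i a b) 0; first by rewrite mulr0.
by rewrite (negbTE nab).
Qed.

Lemma walkKernel_finite a : finite_set [set b | walkKernel p alpha a b != 0].
Proof.
apply: sub_finite_set (finite_blockLength_le (blockLength a).+1) => b /=.
exact: walkKernel_neq0_blockLength.
Qed.

Lemma nstep_walk_blockLength {n a b} :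
  0 < nstep (walkKernel p alpha) n a b -> (blockLength b <= blockLength a + n)%N.
Proof.
elim: n a => [|n IH] a; first by rewrite /= ltr0n lt0b addn0 => /eqP->.
move=> /(nstep_gt0_inv walkKernel_ge0)[c ac /IH] /leq_trans; apply.
by rewrite addnS -addSn leq_add2r walkKernel_neq0_blockLength ?gt_eqF.
Qed.

Lemma reduced_appendLetter {x i} (v : V i) :
  wtype x <> Some i -> reduced o (appendLetter x v).
Proof.
rewrite /appendLetter; case: eqP => [_ _|/eqP nv]; first exact: word_reduced.
case: x => -[|b s] /= red; rewrite /wtype /= => ti.
  by rewrite /reduced /= nv.
move: red; rewrite /reduced /= all_rcons rcons_path /= nv => /andP[/andP[-> ->] ->] /=.
by apply/eqP => e; apply: ti; rewrite e.
Qed.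

Lemma reduced_rcons_inv {s i} {v : V i} : reduced o (rcons s (Tagged V v)) ->
  exists x, [/\ word x = s, wtype x <> Some i & v != o i].
Proof.
rewrite /reduced all_rcons /= -andbA => /and3P[nv al so].
have red : reduced o s.
  rewrite /reduced al /=; case: s so {al} => //= b s.
  by rewrite rcons_path => /andP[].
exists (FreeProduct red); split=> //; rewrite /wtype /=.
case: s so {al red} => //= b s; rewrite rcons_path => /andP[_ /=] /eqP H [].
by move=> e; apply: H; rewrite e.
Qed.

(** A path in [V i] is copied step by step into the copy of [V i] attached at [x]. Its intermediate
    points are reduced words because [x] does not end in a letter of [V i]. *)
Lemma nstep_lift {n i x a b} {u v : V i} : wtype x <> Some i ->
  word a = appendLetter x u -> word b = appendLetter x v ->
  0 < nstep (p i) n u v -> 0 < nstep (walkKernel p alpha) n a b.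
Proof.
move=> tx + eb; elim: n a u => [|n IH] a u ea.
  rewrite /= ltr0n lt0b => /eqP uv.
  by rewrite (_ : a = b) ?eqxx ?ltr01//; apply: val_inj; rewrite /= ea eb uv.
move=> /(nstep_gt0_inv (p_ge0 i))[w puw nwv].
pose c := FreeProduct (reduced_appendLetter w tx).
apply: (@nstep_gt0S _ _ _ walkKernel_ge0 walkKernel_finite n a c b); last exact: IH nwv.
by apply: (@walkKernel_gt0 i); rewrite (liftKernelE p tx ea (erefl (word c))).
Qed.

Hypothesis p_reach : forall i (x : V i), exists n : nat, 0 < nstep (p i) n (o i) x.

(** Induction on the last letter: reach the prefix first, then follow a lifted path from [o i] to
    [v] in the copy of [V i] attached there. *)
Lemma walk_reach x : exists n, 0 < nstep (walkKernel p alpha) n (emptyWord o) x.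
Proof.
case: x => s; elim/last_ind: s => [|s [i v] IH] red.
  by exists 0%N; rewrite (_ : FreeProduct red = emptyWord o) /nstep ?eqxx ?ltr01//; exact: val_inj.
have [x [ex tx nv]] := reduced_rcons_inv red.
have reds : reduced o s by rewrite -ex word_reduced.
have [m Hm] := IH reds; have [n Hn] := p_reach i v.
have exs : x = FreeProduct reds by exact: val_inj.
exists (m + n)%N; apply: (nstep_gt0_trans walkKernel_ge0 walkKernel_finite Hm).
apply: (nstep_lift tx _ _ Hn); rewrite /appendLetter ?eqxx ?(negbTE nv)//=; by rewrite ex.
Qed.

Lemma graphLength_ge0 x : 0 <= graphLength p alpha x.
Proof.
have [n Hn] := walk_reach x.
by apply: lb_le_inf; [exists n%:R, n | move=> _ [m _ <-]; rewrite ler0n].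
Qed.

Lemma graphLength_le {n x} :
  0 < nstep (walkKernel p alpha) n (emptyWord o) x -> graphLength p alpha x <= n%:R.
Proof.
move=> Hn; apply: ge_inf; last by exists n.
by exists 0 => _ [m _ <-]; rewrite ler0n.
Qed.

(** A step of the walk adds at most one block. Reachability is essential, since the infimum of an
    empty set would be 0 by default. The comparison puts graph balls inside the finite block-length
    balls. *)
Lemma blockLength_le_graphLength x : (blockLength x)%:R <= graphLength p alpha x.
Proof.
have [n Hn] := walk_reach x.
apply: lb_le_inf; first by exists n%:R, n.
by move=> _ [m /nstep_walk_blockLength + <-]; rewrite add0n ler_nat.
Qed.

Lemma finite_graphLength_le n :
  finite_set [set x : freeProduct o | graphLength p alpha x <= n%:R].
Proof.
apply: sub_finite_set (finite_blockLength_le n) => x /= xn.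
by rewrite -(ler_nat R); apply: le_trans xn; exact: blockLength_le_graphLength.
Qed.

End Words.

(** * Laws of random variables with countably many values *)

Section CountableValued.
Context {R : realType} {d : measure_display} {Omega : measurableType d}.
Variable Pr : probability Omega R.

Lemma negligible_bigcup_countable (I : countType) (F : I -> set Omega) :
  (forall i, Pr.-negligible (F i)) -> Pr.-negligible (\bigcup_i F i).
Proof.
move=> nF; pose G n := if choice.unpickle n is Some i then F i else set0.
apply: (@negligibleS _ _ _ Pr (\bigcup_n G n) _).
  by move=> w [i _ Fiw]; exists (choice.pickle i) => //; rewrite /G choice.pickleK.
apply: negligible_bigcup => n; rewrite /G.
by case: choice.unpickle => [i|]; [exact: nF | exact: negligible_set0].
Qed.

Section OneVariable.
Context {T : countType}.
Variable Y : Omega -> T.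
Hypothesis mY : forall x, measurable (Y @^-1` [set x]).

Lemma measurable_preimage_countType (A : set T) : measurable (Y @^-1` A).
Proof.
rewrite (_ : _ @^-1` _ = \bigcup_x (Y @^-1` ([set x] `&` A))); last first.
  by apply/seteqP; split=> w /= => [Aw|[x _ []]//]; exists (Y w).
apply: countable_bigcupT_measurable => [|x]; first exact: countableP.
have [Ax|nAx] := pselect (A x).
  by rewrite (_ : _ `&` _ = [set x]) //; apply/setIidl => _ ->.
by rewrite (_ : _ `&` _ = set0) ?preimage_set0//; apply/seteqP; split=> // _ [->].
Qed.

Lemma measurable_fun_countType (d' : measure_display) (U : measurableType d') (f : T -> U) :
  measurable_fun setT (f \o Y).
Proof. by move=> _ B _; rewrite setTI; exact: (measurable_preimage_countType (f @^-1` B)). Qed.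

Lemma lawE x : (law Pr Y x)%:E = Pr (Y @^-1` [set x]).
Proof. by rewrite /law fineK// fin_num_measure. Qed.

Lemma law_ge0 x : 0 <= law Pr Y x.
Proof. by rewrite -lee_fin lawE measure_ge0. Qed.

Lemma law_le1 x : law Pr Y x <= 1.
Proof. by rewrite -lee_fin lawE probability_le1. Qed.

Lemma negligible_law0 (A : set T) :
  (forall x, A x -> law Pr Y x = 0) -> Pr.-negligible (Y @^-1` A).
Proof.
move=> A0; apply: (@negligibleS _ _ _ Pr (\bigcup_x (Y @^-1` ([set x] `&` A))) _).
  by move=> w /= Aw; exists (Y w).
apply: negligible_bigcup_countable => x; have [Ax|nAx] := pselect (A x).
  apply: (@negligibleS _ _ _ Pr (Y @^-1` [set x]) _); first by move=> w [].
  by apply/negligibleP => //; apply/esym; have := lawE x; rewrite A0.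
apply: (@negligibleS _ _ _ Pr set0 _); last exact: negligible_set0.
by move=> w /= [e]; rewrite e.
Qed.

(** Almost surely [Y] takes its values in [s], so the integrand agrees almost everywhere with a
    finite combination of indicators of fibres, which integrates term by term. *)
Lemma integral_law (s : {fset T}) (phi : T -> R) : (forall x, 0 <= phi x) ->
  (forall x, x \notin s -> law Pr Y x = 0) ->
  (\int[Pr]_w (phi (Y w))%:E)%E = (\sum_(x <- s) phi x * law Pr Y x)%:E.
Proof.
move=> phi0 s0.
pose G x w := ((phi x)%:E * (\1_(Y @^-1` [set x]) w)%:E)%E.
have mI x : measurable_fun setT (EFin \o (\1_(Y @^-1` [set x]) : Omega -> R)).
  by apply/measurable_EFinP; exact: measurable_indic.
have mG x : measurable_fun setT (G x) by apply: measurable_funeM; exact: mI.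
have G0 x w : (0 <= G x w)%E by rewrite mule_ge0// lee_fin// indicE ler0n.
rewrite (@ae_eq_integral _ _ _ _ _ (fun w => \sum_(x <- s) G x w)%E)//.
- rewrite ge0_integral_sum//= -sumEFin; apply: eq_bigr => x _.
  by rewrite /G ge0_integralZl ?lee_fin ?integral_indic ?setIT ?EFinM ?lawE//; exact: mI.
- exact: (measurable_fun_countType _ _ (EFin \o phi)).
- exact: emeasurable_sum.
(* Outside this null event only the term of index [Y w] survives in the sum. *)
- apply: (@negligibleS _ _ _ Pr (Y @^-1` [set x | x \notin s]) _); last exact: negligible_law0.
  move=> w /=; apply: contra_notN => ws _.
  rewrite (big_fsetD1 (Y w))//= big1_seq/= ?adde0.
    by rewrite /G indicE mem_set//= mule1.
  move=> x; rewrite !inE => /andP[xw _].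
  rewrite /G indicE memNset ?mule0//= => e; by rewrite -e eqxx in xw.
Qed.

Lemma probability_law (s : {fset T}) (A : pred T) :
  (forall x, x \notin s -> law Pr Y x = 0) ->
  Pr (Y @^-1` [set x | A x]) = (\sum_(x <- s | A x) law Pr Y x)%:E.
Proof.
move=> s0; rewrite -[X in Pr X]setIT -integral_indic//; last exact: measurable_preimage_countType.
rewrite (_ : (fun w => _) = (fun w => ((A (Y w))%:R)%:E)); last first.
  apply/funext => w; rewrite indicE; congr (_%:R%:E).
  by apply: congr1; apply/idP/idP => [/set_mem|/mem_set].
rewrite (@integral_law s (fun x => (A x)%:R))// [in RHS]big_mkcond/=.
by congr EFin; apply: eq_bigr => x _; case: (A x); rewrite ?mul1r ?mul0r.
Qed.

End OneVariable.

End CountableValued.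

(** * The entropy bound on finitely many points, and auxiliary limits *)

Lemma ln_nat_ge0 (R : realType) n : 0 <= ln (n%:R : R).
Proof.
case: n => [|n]; first by rewrite ln0.
by rewrite ln_ge0// ler1n.
Qed.

(* The inequality [ln t <= t - 1] at [t = 1 / (N * w x)]. *)
Lemma entropy_sum_le (R : realType) (T : Type) (s : seq T) (w : T -> R) N :
  (forall x, 0 <= w x) -> (size s <= N)%N ->
  \sum_(x <- s) - ln (w x) * w x <= (\sum_(x <- s) w x) * ln N%:R + 1.
Proof.
move=> w0; case: N => [|N] sN.
  by move: sN; rewrite leqn0 => /nilP->; rewrite !big_nil mul0r add0r ler01.
have N0 : 0 < N.+1%:R :> R by rewrite ltr0n.
have step x : - ln (w x) * w x <= w x * ln N.+1%:R + N.+1%:R^-1.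
  have [->|wx] := eqVneq (w x) 0; first by rewrite mulr0 mul0r add0r invr_ge0 ltW.
  have wx0 : 0 < w x by rewrite lt_def wx w0.
  have Nw : 0 < N.+1%:R * w x by rewrite mulr_gt0.
  have := @le_ln1Dx R ((N.+1%:R * w x)^-1 - 1).
  rewrite ltrBrDr addNr invr_gt0 Nw => /(_ isT).
  rewrite addrCA subrr addr0 lnV ?posrE// lnM ?posrE// => H.
  have : (- (ln N.+1%:R + ln (w x))) * w x <= (N.+1%:R * w x)^-1 * w x.
    by rewrite ler_pM2r//; apply: le_trans H _; rewrite lerBlDr lerDl ler01.
  rewrite invfM -mulrA mulVf// mulr1 opprD mulrDl mulNr => H2.
  by rewrite -lerBlDl [w x * _]mulrC addrC.
apply: (@le_trans _ _ (\sum_(x <- s) (w x * ln N.+1%:R + N.+1%:R^-1))); first exact: ler_sum.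
(* The error terms [1 / N] add up to [size s / N], at most 1. *)
rewrite big_split/= -mulr_suml lerD2l big_const_seq count_predT iter_addr_0 -(mulr_natl N.+1%:R^-1).
by rewrite ler_pdivrMr// mul1r ler_nat.
Qed.

(** The tail unions [F N] decrease to the event that [u n] exceeds [c] infinitely often. That event
    is null because the almost sure limit lies below [c], and continuity from above gives
    [Pr (F N) --> 0]. *)
Lemma cvg_probability_of_ae (R : realType) (d : measure_display)
    (Omega : measurableType d) (Pr : probability Omega R)
    (u : nat -> Omega -> R) (l c : R) :
  (forall n, measurable [set w | c < u n w]) -> l < c ->
  {ae Pr, forall w, u n w @[n --> \oo] --> l} ->
  fine (Pr [set w | c < u n w]) @[n --> \oo] --> (0 : R).
Proof.
move=> mu lc uae; pose F N := \bigcup_(n in [set n | (N <= n)%N]) [set w | c < u n w].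
have mF N : measurable (F N) by apply: bigcup_measurable => n _; exact: mu.
have mcap : measurable (\bigcap_N F N) by apply: bigcap_measurable => [|N _]; [exists 0%N | exact: mF].
have F0 : Pr (\bigcap_N F N) = 0%E.
  apply/negligibleP => //; apply: negligibleS uae => w /= capw uw.
  have [N _ HN] : \forall n \near \oo, u n w < c by exact: (@cvgr_lt _ _ _ _ _ _ uw).
  have [n /= Nn] := capw N I; apply/negP; rewrite -leNgt ltW//; exact: HN.
have cvF : fine (Pr (F n)) @[n --> \oo] --> (0 : R).
  have finF : (Pr (F 0%N) < +oo)%E by rewrite ltey_eq fin_num_measure.
  have dF : {homo F : n m / (n <= m)%N >-> (m <= n)%O}.
    move=> m n mn; apply/subsetPset => w [k /= nk H].
    by exists k => //=; exact: leq_trans nk.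
  by have := nonincreasing_cvg_mu finF mF mcap dF; rewrite [X in _ --> X]F0 => /fine_cvg.
apply: (@squeeze_cvgr _ _ _ _ (fun=> 0) (fun n => fine (Pr (F n)))) => //; last exact: cvg_cst.
near=> n; rewrite fine_ge0 ?measure_ge0//=.
rewrite fine_le ?fin_num_measure ?le_measure ?inE//.
by move=> w ?; exists n => //=.
Unshelve. all: end_near. Qed.

Lemma cvg_invn (R : realType) : (n%:R^-1 : R) @[n --> \oo] --> (0 : R).
Proof. by rewrite -cvg_shiftS; exact: cvg_harmonic. Qed.

Lemma cvg_truncn_mul (R : realType) (c : R) : 0 <= c ->
  ((Num.truncn (c * n%:R)).+1%:R / n%:R : R) @[n --> \oo] --> c.
Proof.
move=> c0; apply: (@squeeze_cvgr _ _ _ _ (fun=> c) (fun n => c + n%:R^-1)).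
- near=> n; have n0 : 0 < n%:R :> R by rewrite ltr0n; near: n; exists 1%N.
  have cn : 0 <= c * n%:R by rewrite mulr_ge0.
  have /andP[h1 h2] := truncn_itv cn.
  rewrite ler_pdivlMr// ltW//= ler_pdivrMr// mulrDl mulVf ?gt_eqF//.
  by rewrite -natr1 lerD2r.
- exact: cvg_cst.
- by rewrite -[X in _ --> X]addr0; apply: cvgD; [exact: cvg_cst | exact: cvg_invn].
Unshelve. all: end_near. Qed.

(** * Entropy, growth and escape for a general length with finite balls *)

Section EntropyGrowth.
Context {R : realType} {T : countType} {len : T -> R}.
Hypothesis len_ge0 : forall x, 0 <= len x.
Hypothesis len_fin : forall n : nat, finite_set [set x | len x <= n%:R].
Context {d : measure_display} {Omega : measurableType d}.
Variable Pr : probability Omega R.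

Let B (n : nat) : {fset T} := fset_set [set x | len x <= n%:R].

Let inB n x : (x \in B n) = (len x <= n%:R).
Proof. by rewrite in_fset_set//; apply/idP/idP => [/set_mem|/mem_set]. Qed.

Lemma expectation_entropy_le (Y : Omega -> T) (m n : nat) :
  (forall x, measurable (Y @^-1` [set x])) ->
  (forall x, law Pr Y x != 0 -> len x <= n%:R) ->
  ('E_Pr[fun w => (- ln (law Pr Y (Y w)))%R] <=
   (ln (#|` B m|)%:R + ln (#|` B n|)%:R * fine (Pr [set w | (m%:R : R) < len (Y w)])
    + 2)%:E)%E.
Proof.
move=> mY supp.
have s0 x : x \notin B n -> law Pr Y x = 0.
  by rewrite inB => H; apply/eqP; apply: contraNT H; exact: supp.
have l0 x := @law_ge0 _ _ _ Pr _ _ mY x; have l1 x := @law_le1 _ _ _ Pr _ _ mY x.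
rewrite unlock (@integral_law _ _ _ Pr _ _ mY (B n) (fun x => - ln (law Pr Y x)))//; last first.
  by move=> x; rewrite oppr_ge0 ln_le0.
have -> : Pr [set w | (m%:R : R) < len (Y w)] = (\sum_(x <- B n | m%:R < len x) law Pr Y x)%:E.
  exact: (@probability_law _ _ _ Pr _ _ mY (B n) (fun x => m%:R < len x)).
rewrite lee_fin/= (bigID (fun x => len x <= m%:R))/=.
(* The constant 2 is shared out: the points of length at most [m] and the longer ones each cost an
   error of 1 in [entropy_sum_le]. *)
have -> : (ln (#|` B m|)%:R : R) +
    ln (#|` B n|)%:R * (\sum_(x <- B n | m%:R < len x) law Pr Y x) + 2 =
  (ln (#|` B m|)%:R + 1) +
    ((\sum_(x <- B n | m%:R < len x) law Pr Y x) * ln (#|` B n|)%:R + 1).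
  by rewrite addrACA [in RHS](mulrC (\sum_(_ <- _ | _) _)).
apply: lerD; last first.
  under eq_bigl do rewrite -ltNge.
  rewrite -[X in X <= _]big_filter -[X in _ <= X * _ + _]big_filter.
  apply: entropy_sum_le => //; rewrite size_filter; exact: count_size.
rewrite -big_filter.
(* The points kept are listed from [B n] but all lie in [B m], whichever of [m] and [n] is larger.
   Their total mass is then bounded by 1. *)
apply: (le_trans (@entropy_sum_le _ _ _ (law Pr Y) #|` B m| l0 _)).
  apply: uniq_leq_size; first exact: (filter_uniq _ (fset_uniq (B n))).
  by move=> x; rewrite mem_filter => /andP[xm _]; have := inB m x; rewrite xm.
rewrite lerD2r ler_piMl ?ln_nat_ge0// big_filter.
rewrite -lee_fin -(@probability_law _ _ _ Pr _ _ mY (B n) (fun x => len x <= m%:R))//.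
by apply: probability_le1; exact: measurable_preimage_countType.
Qed.

Variable X : nat -> Omega -> T.
Hypothesis mX : forall n x, measurable (X n @^-1` [set x]).
Hypothesis X_supp : forall n x, law Pr (X n) x != 0 -> len x <= n%:R.

(** An almost sure property holds on at least one trajectory, and along it the limit is one of
    nonnegative quotients. This makes [l + e] positive below. *)
Lemma rateOfEscape_ge0 l : isRateOfEscape len Pr X l -> 0 <= l.
Proof.
move=> ll; have PT : (0 < Pr setT)%E by rewrite probability_setT lte01.
have PF : ProperFilter (almost_everywhere Pr) := ae_properfilter_algebraOfSetsType PT.
have [w /= cw] := @filter_ex _ _ PF _ ll.
apply: (@ler_cvg_to _ _ _ _ (fun=> 0) _ _ _ _ cw); first exact: cvg_cst.
by near=> n; rewrite divr_ge0.
Unshelve. all: end_near. Qed.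

Lemma entropy_le_growth_escape (h l g : R) :
  isAsymptoticEntropy Pr X h -> isRateOfEscape len Pr X l ->
  isGrowthRate len g -> h <= g * l.
Proof.
move=> hh ll gg; have l0 := rateOfEscape_ge0 _ ll.
suff main e : 0 < e -> h <= g * (l + e).
  (* To absorb [g * e'] into a given [e], take [e' = e / (|g| + 1)]; the added 1 keeps the
     denominator positive when [g = 0]. *)
  apply/ler_addgt0Pr => e e0; have g1 : 0 < `|g| + 1 by rewrite ltr_wpDl.
  have := main (e / (`|g| + 1)) (divr_gt0 e0 g1).
  rewrite mulrDr => /le_trans; apply; rewrite lerD2l mulrA ler_pdivrMr//.
  rewrite mulrC ler_pM2l//; apply: le_trans (ler_norm g) _; by rewrite lerDl.
move=> e0; set c := l + e.
have c0 : 0 < c by rewrite ltr_wpDl.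
(* The successor gives [c * n < m n], so [len (X n w) > m n] forces [len (X n w) / n > c]; it also
   makes [m n] nonzero, hence a legitimate divisor. *)
pose m n := (Num.truncn (c * n%:R)).+1.
pose delta n := fine (Pr [set w | (m n)%:R < len (X n w)]).
have mpre n (A : pred T) : measurable [set w | A (X n w)].
  exact: (@measurable_preimage_countType _ _ _ (X n) (mX n) [set x | A x]).
have cd : delta n @[n --> \oo] --> (0 : R).
  have lc : l < c by rewrite ltrDl.
  have := @cvg_probability_of_ae _ _ _ Pr (fun n w => len (X n w) / n%:R) l c
    (fun n => mpre n (fun x => c < len x / n%:R)) lc ll.
  apply: (@squeeze_cvgr _ _ _ _ (fun=> 0)) => //; last exact: cvg_cst.
  near=> n; have n0 : 0 < n%:R :> R by rewrite ltr0n; near: n; exists 1%N.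
  rewrite fine_ge0 ?measure_ge0//=.
  have m1 := mpre n (fun x => (m n)%:R < len x).
  have m2 := mpre n (fun x => c < len x / n%:R).
  rewrite fine_le ?fin_num_measure ?le_measure ?inE//= => w /=.
  rewrite ltr_pdivlMr//; apply: lt_trans.
  by have /andP[] := truncn_itv (mulr_ge0 (ltW c0) (ltW n0)).
have cm : m n @[n --> \oo] --> \oo.
  apply/cvgnyPge => A; near=> n.
  rewrite -(ler_nat R) ltW//.
  apply: (@le_lt_trans _ _ (c * n%:R)).
    rewrite mulrC -ler_pdivrMr//; near: n; exact: nbhs_infty_ger.
  by have /andP[] := truncn_itv (mulr_ge0 (ltW c0) (ler0n R n)).
(* This is the bound of [expectation_entropy_le] divided by [n]. The factor [m n / n] is split off
   so that the growth limit applies along the indices [m n], which tend to infinity. *)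
pose b n : R := (ln (#|` B (m n)|)%:R / (m n)%:R) * ((m n)%:R / n%:R) +
  (ln (#|` B n|)%:R / n%:R) * delta n + 2 * n%:R^-1.
have cb : b n @[n --> \oo] --> g * c + g * 0 + 2 * 0.
  apply: cvgD; last by apply: cvgM; [exact: cvg_cst | exact: cvg_invn].
  apply: cvgD; last exact: cvgM gg cd.
  by apply: cvgM; [exact: (cvg_comp m _ cm gg) | exact: cvg_truncn_mul _ _ (ltW c0)].
rewrite !mulr0 !addr0 in cb.
have cbE : (b n)%:E @[n --> \oo] --> (g * c)%:E.
  by apply: cvg_EFin cb; near=> n.
rewrite -lee_fin; apply: (lee_cvg_to hh cbE).
near=> n; have n0 : 0 < n%:R :> R by rewrite ltr0n; near: n; exists 1%N.
have := @expectation_entropy_le (X n) (m n) n (mX n) (X_supp n).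
move=> /(lee_wpmul2l _) => /(_ (n%:R^-1)%:E); rewrite lee_fin invr_ge0 ltW// => /(_ isT).
move=> /le_trans; apply; rewrite -EFinM lee_fin le_eqVlt; apply/orP; left; apply/eqP.
have mn0 : (m n)%:R != 0 :> R by rewrite pnatr_eq0.
rewrite !mulrDr; congr (_ + _ + _).
- by rewrite mulrA divfK// mulrC.
- by rewrite /delta mulrA [n%:R^-1 * _]mulrC.
- by rewrite -mulrDr mulrC.
Unshelve. all: end_near. Qed.

End EntropyGrowth.

(** * The support of the law of a Markov chain at time [n] *)

Section ChainSupport.
Context {R : realType} {T : countType} {q : T -> T -> R} {x0 : T}.
Hypothesis q_ge0 : forall x y, 0 <= q x y.
Hypothesis q_fin : forall x, finite_set [set y | q x y != 0].
Context {d : measure_display} {Omega : measurableType d}.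
Context {Pr : probability Omega R} {X : nat -> Omega -> T}.
Hypothesis X_chain : markovChain q x0 Pr X.

(** By the product formula, a cylinder of nonzero mass has a shorter cylinder of nonzero mass and a
    positive last transition. At time 0 it must start at [x0], since the complement of that event is
    null. *)
Lemma cylinder_nstep_gt0 n (x : nat -> T) :
  Pr [set w | forall k, (k <= n)%N -> X k w = x k] <> 0%E ->
  0 < nstep q n x0 (x n).
Proof.
have [mX X0 XS] := X_chain; elim: n => [|n IH] H.
  suff -> : x 0%N = x0 by rewrite /nstep eqxx ltr01.
  apply: contrapT => ne; apply: H.
  have -> : [set w | forall k, (k <= 0)%N -> X k w = x k] = X 0%N @^-1` [set x 0%N].
    by apply/seteqP; split=> w /= => [|e k]; [exact | rewrite leqn0 => /eqP->].
  apply: (@subset_measure0 _ _ _ Pr _ (~` (X 0%N @^-1` [set x0]))) => //.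
  - exact: measurableC.
  - by move=> w /= ->.
  - by have := probability_setC Pr (mX 0%N x0); rewrite X0 subee.
have q0 : 0 < q (x n) (x n.+1).
  rewrite lt_def q_ge0 andbT; apply/eqP => e; apply: H.
  by rewrite XS e mule0.
(* [nstep] peels off the first transition whereas cylinders grow at the end, so the last transition
   is joined by concatenation of paths. *)
rewrite -addn1; apply: (nstep_gt0_trans q_ge0 q_fin (IH _)).
  by move=> e; apply: H; rewrite XS e mul0e.
by apply: (@nstep_gt0S _ _ _ q_ge0 q_fin 0 _ _ _ q0); rewrite /= addn1 eqxx ltr01.
Qed.

(** If [y] cannot be reached in [n] steps, every cylinder ending at [y] is null, and countably many
    of them cover the event [X n = y]. *)
Lemma law_neq0_nstep_gt0 n y : law Pr (X n) y != 0 -> 0 < nstep q n x0 y.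
Proof.
have [mX _ _] := X_chain.
apply: contraNT => nn; pose cyl (x : nat -> T) := [set w | forall k, (k <= n)%N -> X k w = x k].
(* Cylinders are indexed by finite sequences, padded with [x0], because these form a countable type,
   unlike functions [nat -> T]. *)
pose F (s : seq T) := if nth x0 s n == y then cyl (nth x0 s) else set0.
suff : Pr.-negligible (X n @^-1` [set y]).
  by move=> /(negligibleP _ (mX n y)) e; rewrite /law e.
apply: (@negligibleS _ _ _ Pr (\bigcup_s F s) _).
  move=> w /= e; exists (mkseq (X ^~ w) n.+1) => //; rewrite /F nth_mkseq// e eqxx.
  by move=> k kn; rewrite nth_mkseq.
apply: negligible_bigcup_countable => s; rewrite /F.
case: eqP => [e|_]; last exact: negligible_set0.
have mc : measurable (cyl (nth x0 s)).
  rewrite (_ : cyl _ = \bigcap_(k in [set k | (k <= n)%N]) (X k @^-1` [set nth x0 s k])).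
    by apply: bigcap_measurable => //; exists 0%N.
  by [].
apply/negligibleP => //; apply: contrapT => /cylinder_nstep_gt0.
by rewrite e (negbTE nn).
Qed.

End ChainSupport.

Theorem corollary6p4 (R : realType) (r : nat) (V : 'I_r -> finType)
  (o : forall i, V i) (p : forall i, V i -> V i -> R) (alpha : 'I_r -> R)
  (r_ge2 : (2 <= r)%N)
  (not_2_2 : ~ (r = 2%N /\ forall i, #|V i| = 2%N))
  (p_stoch : forall i, stochastic (p i))
  (p_reach : forall i (x : V i), exists n : nat, 0 < nstep (p i) n (o i) x)
  (p_noloop : forall i (x : V i), p i x x = 0)
  (alpha_gt0 : forall i, 0 < alpha i)
  (alpha_sum : \sum_(i < r) alpha i = 1)
  (green_gt1 : (1 < greenRadius o p alpha)%E)
  (d : measure_display) (Omega : measurableType d) (Pr : probability Omega R)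
  (X : nat -> Omega -> freeProduct o)
  (X_chain : markovChain (walkKernel p alpha) (emptyWord o) Pr X)
  (h ell0 ell1 g0 g1 : R)
  (h_lim : isAsymptoticEntropy Pr X h)
  (ell0_lim : isRateOfEscape (fun x : freeProduct o => (blockLength x)%:R) Pr X ell0)
  (ell1_lim : isRateOfEscape (graphLength p alpha) Pr X ell1)
  (g0_lim : isGrowthRate (fun x : freeProduct o => (blockLength x)%:R) g0)
  (g1_lim : isGrowthRate (@graphLength R r V o p alpha) g1) :
  h <= g0 * ell0 /\ h <= g1 * ell1.
Proof.
have p_ge0 i x y : 0 <= p i x y by case: (p_stoch i).
have [mX _ _] := X_chain.
(* A value charged at time [n] is reachable in exactly [n] steps, so both of its lengths are at most
   [n], as the general bound requires. *)
have supp n x : law Pr (X n) x != 0 -> 0 < nstep (walkKernel p alpha) n (emptyWord o) x.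
  apply: (law_neq0_nstep_gt0 _ _ X_chain) => [a b|a].
    exact: walkKernel_ge0.
  exact: walkKernel_finite.
split.
  apply: (entropy_le_growth_escape _ _ _ _ mX _ _ _ _ h_lim ell0_lim g0_lim) => [x|n|n x].
  - exact: ler0n.
  - apply: sub_finite_set (finite_blockLength_le o n) => x /=; by rewrite ler_nat.
  - by move=> /supp /nstep_walk_blockLength; rewrite add0n ler_nat; apply.
apply: (entropy_le_growth_escape _ _ _ _ mX _ _ _ _ h_lim ell1_lim g1_lim) => [x|n|n x].
- exact: graphLength_ge0.
- exact: finite_graphLength_le.
- by move=> /supp /graphLength_le.
Qed.
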